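(* Let $\mathcal{H}$ be a complex Hilbert space, let $A\in\mathcal{B}(\mathcal{H})$ be positive semidefinite, and let $T\in\mathcal{B}_{A^{1/2}}(\mathcal{H})$. Then the following conditions are equivalent: (i) $dw_A(T)=w_A(T)$; (ii) $AT=0$.
   Context: $\mathcal{B}(\mathcal{H})$ is the algebra of bounded linear operators on the complex Hilbert space $\mathcal{H}$. For a positive semidefinite $A\in\mathcal{B}(\mathcal{H})$ (i.e. $\langle Ax,x\rangle\ge 0$ for all $x$), put $\langle x,y\rangle_A=\langle Ax,y\rangle$ and $\|x\|_A=\sqrt{\langle x,x\rangle_A}$. $\mathcal{B}_{A^{1/2}}(\mathcal{H})$ is the set of $T\in\mathcal{B}(\mathcal{H})$ that are $A$-bounded: there is $c>0$ with $\|Tx\|_A\le c\|x\|_A$ for all $x\in\mathcal{H}$. For $T\in\mathcal{B}_{A^{1/2}}(\mathcal{H})$: the $A$-numerical radius is $w_A(T)=\sup\{|\langle Tx,x\rangle_A|: x\in\mathcal{H},\|x\|_A=1\}$, and the $A$-Davis-Wielandt radius is $dw_A(T)=\sup\{\sqrt{|\langle Tx,x\rangle_A|^2+\|Tx\|_A^4}: x\in\mathcal{H},\|x\|_A=1\}$. *)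

(* Defs.v *)
From HB Require Import structures.
From mathcomp Require Import all_boot all_order all_algebra.
From mathcomp Require Import sesquilinear complex.
From mathcomp Require Import all_classical all_reals all_analysis.

Set Implicit Arguments.
Unset Strict Implicit.
Unset Printing Implicit Defensive.

Import Order.TTheory GRing.Theory Num.Theory.
Import numFieldNormedType.Exports.

Local Open Scope classical_set_scope.
Local Open Scope ring_scope.
Local Open Scope complex_scope.

(* A complex Hilbert space is a complete normed R[i]-module H together with a
   positive definite Hermitian form [dot], linear in its first argument, that
   induces the norm of H. *)
Definition induces_norm (R : realType) (H : normedModType R[i])
    (dot : {dot H for Num.conj}) : Prop :=
  forall x : H, `|x| ^+ 2 = dot x x.

Definition bounded_operator (R : realType) (H : normedModType R[i])
    (T : {linear H -> H}) : Prop :=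
  exists c : R, forall x : H, `|T x| <= c%:C * `|x|.

(* In R[i], [0 <= z] means that z is real and nonnegative. *)
Definition positive_semidefinite (R : realType) (H : normedModType R[i])
    (dot : {dot H for Num.conj}) (A : {linear H -> H}) : Prop :=
  forall x : H, 0 <= dot (A x) x.

Definition dotA (R : realType) (H : normedModType R[i])
    (dot : {dot H for Num.conj}) (A : {linear H -> H}) (x y : H) : R[i] :=
  dot (A x) y.

(* [complex.Re] only changes the type: [dotA dot A x x] is real whenever A is
   positive semidefinite. *)
Definition normA (R : realType) (H : normedModType R[i])
    (dot : {dot H for Num.conj}) (A : {linear H -> H}) (x : H) : R :=
  Num.sqrt (complex.Re (dotA dot A x x)).

Definition A_bounded (R : realType) (H : normedModType R[i])
    (dot : {dot H for Num.conj}) (A T : {linear H -> H}) : Prop :=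
  exists2 c : R, 0 < c & forall x : H, normA dot A (T x) <= c * normA dot A x.

(* [sup] is real-valued. The suprema below are over sets that are bounded when
   T is A-bounded, and that are empty only when A = 0, where [sup set0 = 0]. *)
Definition numerical_radiusA (R : realType) (H : normedModType R[i])
    (dot : {dot H for Num.conj}) (A T : {linear H -> H}) : R :=
  sup [set Normc.normc (dotA dot A (T x) x) | x in [set x | normA dot A x = 1]].

Definition davis_wielandt_radiusA (R : realType) (H : normedModType R[i])
    (dot : {dot H for Num.conj}) (A T : {linear H -> H}) : R :=
  sup [set Num.sqrt (Normc.normc (dotA dot A (T x) x) ^+ 2
                     + normA dot A (T x) ^+ 4)
       | x in [set x | normA dot A x = 1]].

(* Main.v *)
(* With f x = |<Tx, x>_A| and g x = ||Tx||_A on the A-unit sphere, Cauchy-Schwarz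
   for the semi-inner product <_, _>_A gives f <= g.  If dw_A(T) = w_A(T) = w,
   then f^2 + f^4 <= f^2 + g^4 <= w^2 on the sphere; letting f tend to its
   supremum w yields w^2 + w^4 <= w^2, so w = 0 and hence g = 0.  Then
   <ATx, Tx> = 0 for all x, and Cauchy-Schwarz again gives
   |<ATx, ATx>| <= ||Tx||_A ||ATx||_A = 0. *)
Require Import Defs.
From HB Require Import structures.
From mathcomp Require Import all_boot all_order all_algebra.
From mathcomp Require Import sesquilinear complex.
From mathcomp Require Import all_classical all_reals all_analysis.
From mathcomp Require Import ring lra.

Import Order.TTheory GRing.Theory Num.Theory.
Import numFieldNormedType.Exports.

Local Open Scope ring_scope.
Local Open Scope complex_scope.

(** Polarization: the diagonal of [f] is real, and reality at [u + v] and at [u + 'i *: v] gives two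
    linear relations between [f u v], [f v u] and their conjugates. Adding them isolates the claim,
    so symmetry follows from positivity alone. *)
Lemma psd_hermitian (C : numClosedFieldType) (U : lmodType C)
    (f : {bilinear U -> U -> C | *%R & Num.conj \; *%R}) :
  (forall x, 0 <= f x x) -> forall u v, Num.conj (f u v) = f v u.
Proof.
move=> f0 u v.
have real w : Num.conj (f w w) = f w w by apply/CrealP/ger0_real.
have := real (u + v); have := real (u + 'i%R *: v).
rewrite !(linearDl, linearDr) /= !(linearZl_LR, linearZr_LR) /=.
rewrite /GRing.scale /= !rmorphD /= !rmorphM /= !real conjCK conjCi.
set a := f u v; set b := f v u; set a' := Num.conj a; set b' := Num.conj b.
move=> h1 h2.
have i0 : 'i%R != 0 :> C by rewrite neq0Ci.
have e1 : a' - b' = b - a.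
  apply: (mulfI i0); move/eqP: h1; rewrite -subr_eq0 => /eqP h1.
  apply/eqP; rewrite -subr_eq0 -[X in _ == X]h1; apply/eqP; ring.
have e2 : a' + b' = a + b.
  move/eqP: h2; rewrite -subr_eq0 => /eqP h2.
  apply/eqP; rewrite -subr_eq0 -[X in _ == X]h2; apply/eqP; ring.
have : 2 * a' = 2 * b.
  have -> : 2 * a' = (a' - b') + (a' + b') by ring.
  rewrite e1 e2; ring.
by apply: mulfI; rewrite pnatr_eq0.
Qed.

Lemma psd_Cauchy_Schwarz (C : numClosedFieldType) (U : lmodType C)
    (f : {bilinear U -> U -> C | *%R & Num.conj \; *%R}) :
  (forall x, 0 <= f x x) ->
  forall u v, `|f u v| ^+ 2 <= f u u * f v v.
Proof.
move=> f0 u v.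
have expand (s t : C) : f (s *: u - t *: v) (s *: u - t *: v) =
    s * Num.conj s * f u u + t * Num.conj t * f v v
    - (s * Num.conj t * f u v + t * Num.conj s * Num.conj (f u v)).
  rewrite (psd_hermitian _ _ f f0) !(linearBl, linearBr) /=.
  rewrite !(linearZl_LR, linearZr_LR) /GRing.scale /=; ring.
have conj_real w : Num.conj (f w w) = f w w by apply/CrealP/ger0_real.
have psd s t := f0 (s *: u - t *: v).
rewrite normCK.
(* The usual choice [s = f v v], [t = f u v] says nothing when [f v v = 0]; then the roles of [u]
   and [v] are exchanged. *)
have [fv0|fv_neq0] := eqVneq (f v v) 0.
  have [fu0|fu_neq0] := eqVneq (f u u) 0.
    (* With both diagonal values zero, positivity at [u - f u v *: v] reads [0 <= - 2 |f u v|^2]. *)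
    have := psd 1 (f u v); rewrite expand fv0 fu0 conjC1.
    set b := f u v.
    have -> : 1 * 1 * 0 + b * Num.conj b * 0
      - (1 * Num.conj b * b + b * 1 * Num.conj b) = - (2 * (b * Num.conj b)).
      by ring.
    by rewrite oppr_ge0 pmulr_rle0 ?ltr0n// mulr0.
  have := psd (Num.conj (f u v)) (f u u).
  rewrite expand fv0 conjCK conj_real; set b := f u v; set q := f u u.
  have -> : Num.conj b * b * q + q * q * 0
      - (Num.conj b * q * b + q * b * Num.conj b) = - (q * (b * Num.conj b)).
    by ring.
  by rewrite oppr_ge0 pmulr_rle0 ?mulr0// lt_def fu_neq0 f0.
have := psd (f v v) (f u v).
rewrite expand conj_real; set b := f u v; set q := f u u; set r := f v v.
have -> : r * r * q + b * Num.conj b * r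
    - (r * Num.conj b * b + b * r * Num.conj b) = r * (q * r - b * Num.conj b).
  by ring.
by rewrite pmulr_rge0 ?subr_ge0// lt_def fv_neq0 f0.
Qed.

(** The bound [c] and the point [x] make both sets bounded and nonempty, so each [sup] is a true
    supremum and not a default value. *)
Lemma sup_DavisWielandt_eq0 (R : realType) (X : Type) (P : set X)
    (f g : X -> R) (c : R) :
  (forall x, P x -> 0 <= f x <= g x) -> (forall x, P x -> g x <= c) ->
  sup [set Num.sqrt (f x ^+ 2 + g x ^+ 4) | x in P] = sup [set f x | x in P] ->
  forall x, P x -> g x = 0.
Proof.
set D := (X in sup X = _); set W := (X in _ = sup X) => fg gc DW x Px.
have leX (a b : R) n : 0 <= a -> a <= b -> a ^+ n <= b ^+ n.
  by move=> a0 ab; rewrite lerXn2r ?nnegrE// (le_trans a0).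
have g0 y : P y -> 0 <= g y by move=> /fg/andP[]; exact: le_trans.
have fc y : P y -> f y <= c by move=> Py; have /andP[_ /le_trans->//] := fg _ Py; exact: gc.
have dle y : P y -> Num.sqrt (f y ^+ 2 + g y ^+ 4) <= Num.sqrt (c ^+ 2 + c ^+ 4).
  move=> Py; have /andP[f0 _] := fg _ Py.
  by rewrite ler_wsqrtr// lerD// leX ?fc ?gc ?g0.
have Dsup : has_sup D.
  split; first by exists (Num.sqrt (f x ^+ 2 + g x ^+ 4)), x.
  by exists (Num.sqrt (c ^+ 2 + c ^+ 4)) => _ [y Py <-]; exact: dle.
have Wsup : has_sup W.
  by split; [exists (f x), x | exists c => _ [y Py <-]; exact: fc].
set w := sup W in DW.
have bound y : P y -> f y ^+ 2 + g y ^+ 4 <= w ^+ 2.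
  move=> Py; have s0 : 0 <= f y ^+ 2 + g y ^+ 4.
    by rewrite addr_ge0 ?sqr_ge0// exprn_ge0// g0.
  rewrite -(sqr_sqrtr s0) leX ?sqrtr_ge0// -DW.
  by apply: ub_le_sup; [case: Dsup | exists y].
have w0 : 0 <= w.
  have /andP[f0 _] := fg _ Px; apply: le_trans f0 _.
  by apply: ub_le_sup; [case: Wsup | exists x].
have w_eq0 : w = 0.
  apply/eqP; rewrite eq_le w0 andbT leNgt; apply/negP => w_gt0.
  (* If w / 2 < f y then w^4 / 16 <= w^2 - f y ^ 2 <= 2 w (w - f y), so f stays
     w^3 / 32 below its supremum. *)
  have [e [e_gt0 e_le2 e_le32]] :
      exists e : R, [/\ 0 < e, e <= w / 2 & e <= w ^+ 3 / 32].
    exists (Num.min (w / 2) (w ^+ 3 / 32)).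
    by rewrite lt_min !divr_gt0 ?exprn_gt0// !ge_min !lexx orbT.
  have [_ [y Py <-] fy] := sup_adherent e_gt0 Wsup.
  have /andP[f0 fgy] := fg _ Py.
  rewrite -/w in fy.
  have fyw : w / 2 < f y by lra.
  have g4 : (w / 2) ^+ 4 <= g y ^+ 4.
    by rewrite leX ?divr_ge0// ltW// (lt_le_trans fyw).
  have fw : f y <= w by apply: ub_le_sup; [case: Wsup | exists y].
  have h1 : (w / 2) ^+ 4 <= (w - f y) * (w + f y).
    have := bound _ Py; move: g4; lra.
  have h2 : (w - f y) * (w + f y) <= (w - f y) * (2 * w).
    by rewrite ler_wpM2l ?subr_ge0//; lra.
  have h3 : (w - f y) * (2 * w) < w ^+ 3 / 32 * (2 * w).
    by rewrite ltr_pM2r ?mulr_gt0//; lra.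
  (* The constant 32 makes the chain [h1], [h2], [h3] close up as [(w / 2) ^+ 4 < (w / 2) ^+ 4]. *)
  have : w ^+ 3 / 32 * (2 * w) = (w / 2) ^+ 4 by field.
  lra.
have := bound _ Px; rewrite w_eq0 expr0n /= => bound0.
have : g x ^+ 4 == 0.
  rewrite eq_le exprn_ge0 ?g0// andbT; have := sqr_ge0 (f x); lra.
by rewrite expf_eq0 => /eqP.
Qed.

Lemma normc_ge0 (R : rcfType) (z : R[i]) : 0 <= Normc.normc z.
Proof. by case: z => a b; exact: sqrtr_ge0. Qed.

Section seminorm.
Variables (R : realType) (H : normedModType R[i]).
Variables (dot : {dot H for Num.conj}) (A : {linear H -> H}).

Let form := dotA dot A.

(** Gives [form] the sesquilinear structure that [psd_Cauchy_Schwarz] expects. *)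
Let form_bilinear : bilinear_for *%R (Num.conj \; *%R) form.
Proof.
split=> x a y z; rewrite /form /dotA; first by rewrite !linearP linearPl.
exact: linearPr.
Qed.

HB.instance Definition _ := bilinear_isBilinear.Build R[i] H H R[i] *%R
  (Num.conj \; *%R) form form_bilinear.

Hypothesis A_pos : positive_semidefinite dot A.

Lemma normA_ge0 x : 0 <= normA dot A x.
Proof. exact: sqrtr_ge0. Qed.

(** By positivity the imaginary part vanishes and the real part is nonnegative, so neither [Re] nor
    the square root loses anything. *)
Lemma sqr_normA x : (normA dot A x ^+ 2)%:C = dotA dot A x x.
Proof.
have := A_pos x; rewrite -/(dotA dot A x x) /normA.
case: (dotA dot A x x) => a b; rewrite lecE /= => /andP[/eqP -> a0].
by rewrite sqr_sqrtr.
Qed.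

Lemma normc_dotA_le x y :
  Normc.normc (dotA dot A x y) <= normA dot A x * normA dot A y.
Proof.
have : `|dotA dot A x y| ^+ 2 <= dotA dot A x x * dotA dot A y y.
  exact: (@psd_Cauchy_Schwarz _ _ form A_pos x y).
(* The norm of [R[i]] is by definition the embedded real modulus, so the inequality descends to
   [R]. *)
rewrite -!sqr_normA -[`|_|]/((Normc.normc (dotA dot A x y))%:C).
rewrite -rmorphXn -rmorphM lecR -exprMn.
by rewrite ler_pXn2r ?nnegrE ?normc_ge0 ?mulr_ge0 ?normA_ge0.
Qed.

Lemma normAZ (a : R) x : 0 <= a -> normA dot A (a%:C *: x) = a * normA dot A x.
Proof.
move=> a0.
have sqr_eq : (normA dot A (a%:C *: x) ^+ 2)%:C = ((a * normA dot A x) ^+ 2)%:C.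
  rewrite sqr_normA exprMn rmorphM /= sqr_normA [a ^+ 2]expr2 rmorphM.
  rewrite -[LHS]/(form (a%:C *: x) (a%:C *: x)) linearZl_LR linearZr_LR /=.
  by rewrite mulrA; congr (_ * _ * _); apply/CrealP/ger0_real; rewrite lecR.
apply/eqP; rewrite -(@eqrXn2 _ 2) ?mulr_ge0 ?normA_ge0//.
by apply/eqP; case: sqr_eq.
Qed.

(** Cauchy-Schwarz against [A x] kills [dot (A x) (A x)], and [dot] is definite. *)
Lemma normA_eq0 x : normA dot A x = 0 -> A x = 0.
Proof.
move=> Ax0; have := normc_dotA_le x (A x); rewrite Ax0 mul0r => le0.
apply/eqP; rewrite -(dnorm_eq0 dot); apply/eqP/Normc.eq0_normc/le_anti.
by rewrite normc_ge0 andbT.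
Qed.

End seminorm.

Theorem theorem2p3 (R : realType) (H : completeNormedModType R[i])
    (dot : {dot H for Num.conj}) (dot_norm : induces_norm dot)
    (A : {linear H -> H}) (A_bdd : bounded_operator A)
    (A_pos : positive_semidefinite dot A)
    (T : {linear H -> H}) (T_bdd : bounded_operator T)
    (T_Abdd : A_bounded dot A T) :
  davis_wielandt_radiusA dot A T = numerical_radiusA dot A T
  <-> (forall x : H, A (T x) = 0).
Proof.
split=> [dw_eq x|AT0].
  have [c _ Tc] := T_Abdd.
  have unit y : normA dot A y = 1 -> normA dot A (T y) = 0.
    apply: (@sup_DavisWielandt_eq0 _ _ [set y | normA dot A y = 1]%classic
      (fun y => Normc.normc (dotA dot A (T y) y)) (fun y => normA dot A (T y)) c
      _ _ dw_eq) => z /= z1; last by have := Tc z; rewrite z1 mulr1.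
    rewrite normc_ge0 /=.
    by have := normc_dotA_le _ _ _ _ A_pos (T z) z; rewrite z1 mulr1.
  apply: (normA_eq0 _ _ _ _ A_pos).
  (* A vector of zero seminorm cannot be normalized; there A-boundedness of [T] gives the claim
     directly. Any other vector is rescaled to the A-unit sphere. *)
  have [x0|x_neq0] := eqVneq (normA dot A x) 0.
    apply/le_anti; rewrite normA_ge0 andbT.
    by have := Tc x; rewrite x0 mulr0.
  have inv_ge0 : 0 <= (normA dot A x)^-1 by rewrite invr_ge0 normA_ge0.
  have := unit ((normA dot A x)^-1%:C *: x).
  rewrite linearZ !normAZ// mulVf// => /(_ erefl)/eqP.
  by rewrite mulf_eq0 invr_eq0 (negPf x_neq0) => /eqP.
have q0 y z : dotA dot A (T y) z = 0 by rewrite /dotA AT0 linear0l.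
(* Both functions vanish identically, so the two image sets coincide, even over an empty sphere. *)
congr sup; apply: eq_imagel => x _.
by rewrite /normA !q0 Normc.normc0 /= sqrtr0 !expr0n /= addr0 sqrtr0.
Qed.
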